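(* Let $u$ be a bounded viscosity solution to the $(F,\gamma)$-obstacle problem in $\Omega$ with obstacle $\phi\in C^{1,\beta}(\Omega)$, $\beta\in(0,1]$, and assume that the continuous source term $f\in L^\infty(\Omega)$ satisfies $\inf_\Omega f=:\mathfrak{m}>0$. Let $\tilde\Omega\subset\subset\Omega$. Then there is a universal constant $\mathfrak{c}>0$ such that, if $x_0\in\{u>\phi\}\cap\tilde\Omega$ and $r:=\mathrm{dist}(x_0,\partial\{u>\phi\})$, then $$\sup_{B_r(x_0)}|Du|\ge \mathfrak{c}\, r^{\frac{1}{\gamma+1}}-\frac12\|D\phi\|_{L^\infty(B_r(x_0))}.$$
   Context: $\Omega\subset\mathbb{R}^n$ is a smooth, open, bounded domain; $\gamma>0$. $F:\mathrm{Sym}(n)\to\mathbb{R}$ is convex, $F(0)=0$, and uniformly elliptic: for some $0<\lambda\le\Lambda<\infty$ and all symmetric $X,Y$, $\mathcal{M}^-_{\lambda,\Lambda}(X-Y)\le F(X)-F(Y)\le \mathcal{M}^+_{\lambda,\Lambda}(X-Y)$, where, with $e_i$ the eigenvalues of $X$, $\mathcal{M}^-_{\lambda,\Lambda}(X)=\lambda\sum_{e_i>0}e_i+\Lambda\sum_{e_i<0}e_i$ and $\mathcal{M}^+_{\lambda,\Lambda}(X)=\Lambda\sum_{e_i>0}e_i+\lambda\sum_{e_i<0}e_i$. Viscosity solutions: a continuous $u$ is a viscosity supersolution (resp. subsolution) of $|Du|^\gamma F(D^2u)=f$ in an open set if for every $C^2$ function $\varphi$ such that $u-\varphi$ has a strict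 minimum (resp. strict maximum) at $x_0$, one has $|D\varphi(x_0)|^\gamma F(D^2\varphi(x_0))\le f(x_0)$ (resp. $\ge f(x_0)$). It is a viscosity solution if it is both. The inequality $|Du|^\gamma F(D^2u)\le f$ in the viscosity sense means $u$ is a supersolution. The $(F,\gamma)$-obstacle problem in $\Omega$ with obstacle $\phi$, source $f$ and boundary datum $g\in C^{1,\beta}(\partial\Omega)$ is: $u\ge\phi$ in $\Omega$; $|Du|^\gamma F(D^2u)\le f$ in $\Omega$; $|Du|^\gamma F(D^2u)=f$ in $\Omega\cap\{u>\phi\}$; $u=g$ on $\partial\Omega$, the differential relations being understood in the viscosity sense. A constant is called universal if it depends only on the given data and not on the solution. *)

(* Defs.v *)
(* MathComp-Analysis: R^n is 'rV[R]_n over R : realType.  The library norm on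
   'rV[R]_n is the sup norm; it induces the usual topology and
   differentiability, but lengths, balls and distances below are Euclidean. *)
From HB Require Import structures.
From mathcomp Require Export all_boot all_order all_algebra.
From mathcomp Require Export all_classical all_reals all_analysis.
Export Order.TTheory GRing.Theory Num.Theory.
Export numFieldNormedType.Exports.

Set Implicit Arguments.
Unset Strict Implicit.
Unset Printing Implicit Defensive.

Local Open Scope classical_set_scope.
Local Open Scope ring_scope.

Section Euclidean.
Variables (R : realType) (n : nat).
Implicit Types (x y : 'rV[R]_n) (S : set 'rV[R]_n).

Definition enorm x : R := Num.sqrt (\sum_(i < n) x 0 i ^+ 2).

Definition eball x (r : R) : set 'rV[R]_n := [set y | enorm (y - x) < r].

Definition edist x S : R := inf [set enorm (y - x) | y in S].

Definition frontier S : set 'rV[R]_n := closure S `\` interior S.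

End Euclidean.

Section Calculus.
Variables (R : realType) (n : nat).
Implicit Types (A : set 'rV[R]_n) (f : 'rV[R]_n -> R) (x : 'rV[R]_n).

Definition partial (i : 'I_n) f : 'rV[R]_n -> R :=
  fun x => 'D_(delta_mx 0 i) f x.

Definition grad f x : 'rV[R]_n := \row_(i < n) partial i f x.

Definition hess f x : 'M[R]_n :=
  \matrix_(i < n, j < n) partial i (partial j f) x.

(* f is of class C^k on the open set A *)
Fixpoint Ck (k : nat) A f : Prop :=
  match k with
  | 0%N => forall x, A x -> {for x, continuous f}
  | k'.+1 => (forall x, A x -> differentiable f x) /\
             forall i, Ck k' A (partial i f)
  end.

(* C^{1,beta}(A), A open: C^1 with locally beta-Hoelder gradient.  Functions
   with finite global C^{1,beta} norm on A are a special case. *)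
Definition C1beta (beta : R) A f : Prop :=
  Ck 1 A f /\
  forall x, A x -> exists (C : R) (U : set 'rV[R]_n), nbhs x U /\
    forall y z, U y -> U z ->
      enorm (grad f y - grad f z) <= C * enorm (y - z) `^ beta.

(* |Du(x)| for a function u not known a priori to be differentiable.  Viscosity
   solutions are only assumed continuous; that they are C^1 where the equation
   holds is a separate regularity theorem.  At points of differentiability this
   is the Euclidean norm of the gradient; elsewhere, the local slope
   limsup_{y -> x} |u y - u x| / |y - x|, with which it agrees at points of
   differentiability, replaces the unspecified value of 'D. *)
Definition gradnorm (u : 'rV[R]_n -> R) x : \bar R :=
  if `[< differentiable u x >] then (enorm (grad u x))%:E
  else limf_esup (fun y => (`|u y - u x| / enorm (y - x))%:E) x^'.

End Calculus.

Section Domains.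
Variables (R : realType) (n : nat).
Implicit Types (Omega D : set 'rV[R]_n).

(* locally, Omega is the sublevel set of a smooth defining function *)
Definition smooth_boundary Omega : Prop :=
  forall p, frontier Omega p ->
    exists (U : set 'rV[R]_n) (rho : 'rV[R]_n -> R),
      [/\ open U, U p, forall k, Ck k U rho, grad rho p != 0 &
          Omega `&` U = [set x | rho x < 0] `&` U].

Definition smooth_bounded_domain Omega : Prop :=
  [/\ open Omega, connected Omega, Omega !=set0, bounded_set Omega &
      smooth_boundary Omega].

Definition compactly_contained D Omega : Prop :=
  compact (closure D) /\ closure D `<=` Omega.

(* C^{1,beta}(boundary of Omega), as traces of C^{1,beta} functions on R^n *)
Definition C1beta_boundary (beta : R) Omega (g : 'rV[R]_n -> R) : Prop :=
  exists2 G : 'rV[R]_n -> R, C1beta beta setT G &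
    forall x, frontier Omega x -> G x = g x.

End Domains.

Section Operator.
Variables (R : realType) (n : nat).
Implicit Types (X Y : 'M[R]_n).

Definition Sym : set 'M[R]_n := [set X | X^T = X].

(* Sums over eigenvalues with multiplicity, the latter being the multiplicity
   [mup] of e as a root of the characteristic polynomial (0 unless e is an
   eigenvalue, so the sums have finite support). *)
Definition sum_pos_eig X : R :=
  \sum_(e \in [set e : R | 0 < e]) e *+ mup e (char_poly X).

Definition sum_neg_eig X : R :=
  \sum_(e \in [set e : R | e < 0]) e *+ mup e (char_poly X).

Definition pucci_min (lam Lam : R) X : R :=
  lam * sum_pos_eig X + Lam * sum_neg_eig X.

Definition pucci_max (lam Lam : R) X : R :=
  Lam * sum_pos_eig X + lam * sum_neg_eig X.

(* F is a function on Sym(n): its values off [Sym] are irrelevant. *)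
Definition uniformly_elliptic (lam Lam : R) (F : 'M[R]_n -> R) : Prop :=
  forall X Y, Sym X -> Sym Y ->
    pucci_min lam Lam (X - Y) <= F X - F Y <= pucci_max lam Lam (X - Y).

End Operator.

Section Viscosity.
Variables (R : realType) (n : nat) (F : 'M[R]_n -> R) (gamma : R).
Implicit Types (A Omega : set 'rV[R]_n) (u f phi g : 'rV[R]_n -> R).

Definition strict_local_min (w : 'rV[R]_n -> R) x0 : Prop :=
  \forall x \near x0^', w x0 < w x.

Definition strict_local_max (w : 'rV[R]_n -> R) x0 : Prop :=
  \forall x \near x0^', w x < w x0.

Definition pde_lhs (psi : 'rV[R]_n -> R) x : R :=
  enorm (grad psi x) `^ gamma * F (hess psi x).

Definition visc_supersol A f u : Prop :=
  Ck 0 A u /\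
  forall psi x0, Ck 2 A psi -> A x0 ->
    strict_local_min (fun x => u x - psi x) x0 -> pde_lhs psi x0 <= f x0.

Definition visc_subsol A f u : Prop :=
  Ck 0 A u /\
  forall psi x0, Ck 2 A psi -> A x0 ->
    strict_local_max (fun x => u x - psi x) x0 -> f x0 <= pde_lhs psi x0.

Definition visc_sol A f u : Prop := visc_supersol A f u /\ visc_subsol A f u.

Definition noncoincidence Omega u phi : set 'rV[R]_n :=
  Omega `&` [set x | phi x < u x].

(* Continuity up to the boundary gives u = g on the boundary its meaning. *)
Definition obstacle_solution Omega phi f g u : Prop :=
  [/\ {within closure Omega, continuous u},
      forall x, Omega x -> phi x <= u x,
      visc_supersol Omega f u,
      visc_sol (noncoincidence Omega u phi) f u &
      forall x, frontier Omega x -> u x = g x].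

End Viscosity.

(* Main.v *)
From mathcomp Require Import ring lra.
Require Import Defs.

(* On the ball B_r(x0), contained in {u > phi}, u is a subsolution with right
   hand side at least m := inf f > 0.  Compare it on the closed ball of radius
   r/2 with the paraboloid a |x - x0|^2.  For a = (K r)^(1/(gamma+1)) / r with K
   a small multiple of m, an interior maximum of the difference would
   contradict the equation, so the maximum is attained at a point y of the sphere
   and u y - u x0 >= a (r/2)^2.  The mean value inequality on the segment
   [x0, y] then gives a point where the slope of u is at least a r/4, which is a
   constant times r^(1/(gamma+1)).  The term in D phi only weakens the bound. *)

Set Implicit Arguments.
Unset Strict Implicit.

Local Open Scope classical_set_scope.
Local Open Scope ring_scope.

(** * Euclidean norm *)

Section EuclideanNorm.
Variables (R : realType) (n : nat).
Implicit Types (x y v : 'rV[R]_n) (N : set 'rV[R]_n).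

Lemma enorm_ge0 x : 0 <= enorm x.
Proof. exact: sqrtr_ge0. Qed.

Lemma sqr_enorm x : enorm x ^+ 2 = \sum_(i < n) x 0 i ^+ 2.
Proof. by rewrite sqr_sqrtr// sumr_ge0// => i _; exact: sqr_ge0. Qed.

Lemma enormZ (t : R) x : enorm (t *: x) = `|t| * enorm x.
Proof.
rewrite /enorm -sqrtr_sqr -sqrtrM ?sqr_ge0// mulr_sumr.
by congr Num.sqrt; apply: eq_bigr => i _; rewrite mxE exprMn.
Qed.

Lemma enorm0 : enorm (0 : 'rV[R]_n) = 0.
Proof. by rewrite -(scale0r 0) enormZ normr0 mul0r. Qed.

Lemma ler_coord_enorm x i : `|x 0 i| <= enorm x.
Proof.
rewrite -(@ler_pXn2r _ 2) ?nnegrE ?enorm_ge0// sqr_enorm real_normK ?num_real//.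
by rewrite (bigD1 i)//= lerDl sumr_ge0// => j _; exact: sqr_ge0.
Qed.

Lemma enorm_eq0 x : enorm x = 0 -> x = 0.
Proof.
move=> x0; apply/rowP => i; rewrite mxE; apply/eqP.
by rewrite -normr_le0 -x0 ler_coord_enorm.
Qed.

(** For [a = enorm x] and [b = enorm y], the nonnegative sum of the squares of
    [b * x 0 i - a * y 0 i] expands to [2 * (a * b) * (a * b - s)], [s] being the inner product.
    Dividing requires both norms to be nonzero. *)
Lemma enorm_CauchySchwarz x y :
  \sum_(i < n) x 0 i * y 0 i <= enorm x * enorm y.
Proof.
have [x0|x_neq0] := eqVneq (enorm x) 0.
  by rewrite x0 (enorm_eq0 x0) mul0r big1// => i _; rewrite mxE mul0r.
have [y0|y_neq0] := eqVneq (enorm y) 0.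
  by rewrite y0 (enorm_eq0 y0) mulr0 big1// => i _; rewrite mxE mulr0.
have xgt0 : 0 < enorm x by rewrite lt_def x_neq0 enorm_ge0.
have ygt0 : 0 < enorm y by rewrite lt_def y_neq0 enorm_ge0.
set a := enorm x in xgt0 *; set b := enorm y in ygt0 *.
set s := \sum_(i < n) _.
have : 0 <= \sum_(i < n) (b * x 0 i - a * y 0 i) ^+ 2.
  by apply: sumr_ge0 => i _; exact: sqr_ge0.
have -> : \sum_(i < n) (b * x 0 i - a * y 0 i) ^+ 2
    = b ^+ 2 * a ^+ 2 + a ^+ 2 * b ^+ 2 - 2 * (a * b) * s.
  rewrite [in X in _ * X + _]sqr_enorm [in X in _ + _ * X - _]sqr_enorm.
  rewrite !mulr_sumr -big_split -sumrB/=.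
  by apply: eq_bigr => i _; ring.
have -> : b ^+ 2 * a ^+ 2 + a ^+ 2 * b ^+ 2 - 2 * (a * b) * s
  = 2 * (a * b) * (a * b - s) by ring.
by rewrite pmulr_rge0 ?subr_ge0// mulr_gt0// mulr_gt0.
Qed.

Lemma continuous_enorm : continuous (@enorm R n).
Proof.
have c : continuous (fun x : 'rV[R]_n => \sum_(i < n) x 0 i ^+ 2).
  apply: continuous_big => [|i _ x]; first exact: add_continuous.
  have ci : {for x, continuous (fun x : 'rV[R]_n => x 0 i)}.
    exact: coord_continuous.
  exact: (cvgM ci ci).
by move=> x; apply: continuous_comp (c x) _; exact: sqrt_continuous.
Qed.

Lemma continuous_enormB x : continuous (fun y : 'rV[R]_n => enorm (y - x)).
Proof.
move=> y; apply: (@continuous_comp _ _ _ (fun y : 'rV[R]_n => y - x)).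
  have cx : {for y, continuous (fun _ : 'rV[R]_n => x)} by exact: cst_continuous.
  have ci : {for y, continuous (fun z : 'rV[R]_n => z)} by exact: cvg_id.
  exact: (continuousB ci cx).
exact: continuous_enorm.
Qed.

(** The Euclidean norm dominates the sup norm, so each sup-norm ball contains the Euclidean ball of
    the same radius. *)
Lemma nbhs_eball N x : nbhs x N -> exists2 d : R, 0 < d & eball x d `<=` N.
Proof.
move=> /nbhs_ballP[d /= d0 dN]; exists d => // y; rewrite /eball /= => yd.
apply: dN; split=> // i j; rewrite !ord1 /ball/= distrC.
apply: le_lt_trans yd; have := ler_coord_enorm (y - x) j.
by rewrite !mxE.
Qed.

Lemma eball_nbhs x y (r : R) : eball x r y -> nbhs y (eball x r).
Proof.
move=> xry.
exact: (@continuous_enormB x y [set t | t < r] (lt_nbhsl xry)).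
Qed.

Lemma compact_closed_eball x (r : R) : compact [set y | enorm (y - x) <= r].
Proof.
have cl : closed [set y | enorm (y - x) <= r].
  apply: (@preimage_closed _ _ (fun y => enorm (y - x)) [set t | t <= r]).
    by move=> y _; exact: continuous_enormB.
  exact: closed_le.
(* The closed Euclidean ball is a closed subset of this cube, a product of segments. *)
have cube : compact [set y : 'rV[R]_n |
    forall i, y ord0 i \in `[x 0 i - r, x 0 i + r]].
  apply: (@rV_compact _ _ (fun i => `[x 0 i - r, x 0 i + r]%classic)).
  by move=> i; exact: segment_compact.
apply: subclosed_compact cl cube _ => y /= yr i.
rewrite in_itv/= -ler_distlC.
by have := ler_coord_enorm (y - x) i; rewrite !mxE distrC => /le_trans; apply.
Qed.

End EuclideanNorm.

(** * Slopes and the mean value inequality *)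

Section Slope.
Variables (R : realType) (n : nat).
Implicit Types (x y v : 'rV[R]_n) (u : 'rV[R]_n -> R).

Lemma derive_le_enorm_grad u x v :
  differentiable u x -> 'D_v u x <= enorm (grad u x) * enorm v.
Proof.
move=> du; have := enorm_CauchySchwarz (grad u x) v.
suff -> : 'D_v u x = \sum_(i < n) (grad u x) 0 i * v 0 i by [].
rewrite deriveE// {1}(row_sum_delta v) linear_sum/=.
by apply: eq_bigr => i _; rewrite linearZ/= mxE /partial deriveE// mulrC.
Qed.

(** A common consequence of both branches of [gradnorm]: the directional derivative is at most
    [enorm (grad u x) * enorm v], and a limsup below [L] bounds all quotients on a punctured
    neighbourhood. *)
Lemma gradnorm_lt_slope u x v (L : R) : (gradnorm u x < L%:E)%E -> v != 0 ->
  \forall t \near (0 : R)^'+, u (x + t *: v) - u x < L * (t * enorm v).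
Proof.
move=> + v0; have v_gt0 : 0 < enorm v.
  by rewrite lt_def enorm_ge0 andbT; apply: contra_neq v0 => /enorm_eq0.
rewrite /gradnorm; case: asboolP => [du|_]; rewrite ?lte_fin.
  move=> gL.
  have dvL : 'D_v u x < L * enorm v.
    by apply: le_lt_trans (derive_le_enorm_grad v du) _; rewrite ltr_pM2r.
  have := @diff_derivable _ _ _ u x v du; rewrite /derivable => cd.
  have : \forall h \near (0 : R)^', h^-1 *: (u (h *: v + x) - u x) < L * enorm v.
    exact: (cd _ (lt_nbhsl dvL)).
  rewrite /dnbhs /at_right !near_withinE => nd.
  near=> t => t0.
  have : t != 0 -> t^-1 *: (u (t *: v + x) - u x) < L * enorm v by near: t.
  rewrite gt_eqF// => /(_ isT).
  by rewrite [t *: v + x]addrC [_ *: _]mulrC ltr_pdivrMr// -mulrA (mulrC _ t).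
move=> gL; have [_ [V xV <-] VL] := ereal_inf_lt gL.
have [d d0 dV] := nbhs_eball xV.
rewrite /at_right near_withinE; near=> t => t0.
have tv0 : 0 < t * enorm v by rewrite mulr_gt0.
have etv : enorm (x + t *: v - x) = t * enorm v.
  by rewrite addrAC subrr add0r enormZ gtr0_norm.
have Vt : V (x + t *: v).
  apply: dV; last first.
    by rewrite -subr_eq0 addrAC subrr add0r scaler_eq0 negb_or v0 gt_eqF.
  rewrite /eball/= etv -ltr_pdivlMr//; near: t.
  by apply: lt_nbhsl; rewrite divr_gt0.
have : ((`|u (x + t *: v) - u x| / enorm (x + t *: v - x))%:E < L%:E)%E.
  by apply: le_lt_trans VL; apply: ereal_sup_ubound; exists (x + t *: v).
rewrite etv lte_fin ltr_pdivrMr//; apply: le_lt_trans; exact: ler_norm.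
Unshelve. all: by end_near. Qed.

End Slope.

(** The point is the supremum of the parameters in [0, 1] satisfying [P]. As [P] may not be closed,
    [P] is only asserted arbitrarily close to it from the left. *)
Lemma last_point_of_segment (R : realType) (P : set R) : P 0 -> ~ P 1 ->
  exists2 s, 0 <= s <= 1 &
    (forall e, 0 < e -> exists2 t, s - e < t <= s & P t) /\
    (forall t, s < t <= 1 -> ~ P t).
Proof.
move=> P0 P1; pose E := [set t : R | 0 <= t <= 1 /\ P t].
have E0 : E 0 by split; rewrite ?lexx ?ler01.
have Eub : ubound E 1 by move=> t [/andP[]].
have supE : has_sup E by split; [exists 0|exists 1].
have leE t : E t -> t <= sup E by move/(sup_upper_bound supE).
have E0sup := leE _ E0.
exists (sup E); first by rewrite E0sup ge_sup//; exists 0.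
split=> [e e0|t /andP[st t1] Pt].
  have [t Et et] := sup_adherent e0 supE.
  by exists t; [rewrite et leE|case: Et].
suff /leE : E t by rewrite leNgt st.
by split=> //; rewrite t1 (le_trans E0sup (ltW st)).
Qed.

Section Segments.
Variables (R : realType) (n : nat).
Implicit Types (x y v : 'rV[R]_n) (u : 'rV[R]_n -> R) (N : set 'rV[R]_n).

Lemma enorm_segmentB x v (s t : R) :
  enorm (x + t *: v - (x + s *: v)) = `|t - s| * enorm v.
Proof. by rewrite opprD addrACA subrr add0r -scalerBl enormZ. Qed.

(** The last point of the segment adherent to [N] from the left is in the closure, and not in the
    interior because the segment stays outside [N] beyond it. *)
Lemma segment_meets_frontier N x y : open N -> N x -> ~ N y ->
  exists2 z, frontier N z & enorm (z - x) <= enorm (y - x).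
Proof.
move=> oN Nx Ny; pose v := y - x.
have v_gt0 : 0 < enorm v.
  rewrite lt_def enorm_ge0 andbT; apply: contra_notN Ny => /eqP/enorm_eq0.
  by move/eqP; rewrite subr_eq0 => /eqP ->.
have [||s /andP[s0 s1] [sP Ps]] :=
  @last_point_of_segment R (fun t => N (x + t *: v)).
- by rewrite scale0r addr0.
- by rewrite scale1r addrC subrK.
exists (x + s *: v); last first.
  rewrite addrAC subrr add0r enormZ ger0_norm//.
  by rewrite ler_piMl// enorm_ge0.
split=> [B /nbhs_eball[d d0 dB]|].
  have [t /andP[st ts] Nt] := sP (d / enorm v) (divr_gt0 d0 v_gt0).
  exists (x + t *: v); split=> //; apply: dB.
  rewrite /eball/= enorm_segmentB distrC ger0_norm ?subr_ge0//.
  by rewrite -ltr_pdivlMr// ltrBlDl -ltrBlDr.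
move=> /nbhs_eball[d d0 dN].
(* For [s = 1] the point would be [y], which the ball would put in [N]. *)
have s_lt1 : s < 1.
  rewrite lt_def s1 andbT; apply: contra_notN Ny => /eqP s1'.
  have := dN (x + s *: v); rewrite /eball/= subrr enorm0 => /(_ d0).
  by rewrite -s1' scale1r addrC subrK.
(* A parameter beyond [s], still on the segment and within the ball of radius [d]. *)
pose t := Num.min 1 (s + d / enorm v / 2).
have de : 0 < d / enorm v by rewrite divr_gt0.
have st : s < t by rewrite lt_min s_lt1/= ltrDl divr_gt0.
apply: (Ps t); first by rewrite st ge_min lexx.
apply: dN; rewrite /eball/= enorm_segmentB ger0_norm ?subr_ge0 ?ltW//.
rewrite -ltr_pdivlMr// ltrBlDl; apply: (@le_lt_trans _ _ (s + d / enorm v / 2)).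
  by rewrite ge_min lexx orbT.
by rewrite ltrD2l ltr_pdivrMr// mulr_natr mulr2n ltrDr.
Qed.

(** Continuous induction along the segment: at the last parameter where the linear bound persists,
    the slope estimate pushes it further. *)
Lemma gradnorm_mean_value u x v (L : R) : 0 <= L ->
  (forall t, 0 <= t <= 1 -> {for x + t *: v, continuous u}) ->
  (forall t, 0 <= t <= 1 -> (gradnorm u (x + t *: v) < L%:E)%E) ->
  u (x + v) - u x <= L * enorm v.
Proof.
move=> L0 cu uL.
have [->|v0] := eqVneq v 0; first by rewrite addr0 subrr enorm0 mulr0.
have v_gt0 : 0 < enorm v.
  by rewrite lt_def enorm_ge0 andbT; apply: contra_neq v0 => /enorm_eq0.
apply: contrapT => nP1.
have [||s /andP[s0 s1] [sP Ps]] := @last_point_of_segment R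
  (fun t => u (x + t *: v) - u x <= L * (t * enorm v)).
- by rewrite scale0r addr0 mul0r mulr0 subrr.
- by rewrite scale1r mul1r.
have s01 : 0 <= s <= 1 by rewrite s0.
(* A strict failure at [s] would persist nearby by continuity. Since [L] is nonnegative, the bound
   for [t <= s] is no larger than the one at [s], so it would fail there too, against [sP]. *)
have Pssq : u (x + s *: v) - u x <= L * (s * enorm v).
  rewrite leNgt; apply/negP => gts.
  set z := x + s *: v in gts.
  have zu : L * (s * enorm v) + u x < u z by rewrite -ltrBrDr.
  have [d d0 dgt] := nbhs_eball (cu _ s01 _ (lt_nbhsr zu)).
  have [t /andP[st ts] Pt] := sP (d / enorm v) (divr_gt0 d0 v_gt0).
  have : eball z d (x + t *: v).
    rewrite /eball/= enorm_segmentB distrC ger0_norm ?subr_ge0//.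
    by rewrite -ltr_pdivlMr// ltrBlDl -ltrBlDr.
  move=> /dgt/=; rewrite ltNge => /negP; apply.
  rewrite -lerBlDr (le_trans Pt)//; apply: ler_wpM2l => //.
  by apply: ler_wpM2r => //; exact: enorm_ge0.
have s_lt1 : s < 1.
  rewrite lt_def s1 andbT; apply: contra_notN nP1 => /eqP s1'.
  by move: Pssq; rewrite -s1' scale1r mul1r.
have : \forall t \near (0 : R)^'+, False; last first.
  by move=> /filter_ex[].
near=> t.
have t0 : 0 < t by near: t; exact: nbhs_right_gt.
have st1 : s + t <= 1.
  rewrite -lerBrDl; apply: ltW; near: t; apply: nbhs_right_lt.
  by rewrite subr_gt0.
apply: (Ps (s + t)); first by rewrite ltrDl t0.
have : u (x + s *: v + t *: v) - u (x + s *: v) < L * (t * enorm v).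
  by near: t; exact: gradnorm_lt_slope (uL _ s01) v0.
rewrite scalerDl addrA; lra.
Unshelve. all: by end_near. Qed.

End Segments.

(** * Paraboloids as test functions *)

Section SumOfTwoParaboloids.
Variables (R : realType) (n : nat) (a b : R) (y z : 'rV[R]_n).
Implicit Types (A : set 'rV[R]_n) (i j : 'I_n).

Let coord i : 'rV[R]_n -> R := fun x => x 0 i.

Let is_derive_coord i (x v : 'rV[R]_n) : is_derive x v (coord i) (v 0 i).
Proof.
have dc : differentiable (coord i) x by exact: differentiable_coord.
apply: DeriveDef; first exact: diff_derivable.
(* Packaged as a continuous linear map, the coordinate is its own differential. *)
have @f : {linear 'rV[R]_n -> R}.
  by exists (coord i); do 2![eexists]; do ?[constructor];
     rewrite /coord ?mxE// => ? *; rewrite ?mxE//; move=> ?; rewrite !mxE.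
have -> : coord i = f by [].
rewrite deriveE ?diff_lin//; exact: coord_continuous.
Qed.

(** The first centre serves the comparison, the second one is for the contact point, where its term
    has zero gradient. *)
Definition paraboloids (x : 'rV[R]_n) : R :=
  a * enorm (x - y) ^+ 2 + b * enorm (x - z) ^+ 2.

(** The contribution of one coordinate, written in the algebra of functions so that the
    differentiation rules apply. *)
Let quad i : 'rV[R]_n -> R :=
  a *: (coord i - cst (y 0 i)) ^+ 2 + b *: (coord i - cst (z 0 i)) ^+ 2.

Let slope i : 'rV[R]_n -> R :=
  (2 * a) *: (coord i - cst (y 0 i)) + (2 * b) *: (coord i - cst (z 0 i)).

Let paraboloidsE : paraboloids = \sum_(i < n) quad i.
Proof.
apply/funext => x; rewrite fct_sumE /paraboloids !sqr_enorm !mulr_sumr.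
by rewrite -big_split/=; apply: eq_bigr => i _; rewrite !mxE.
Qed.

Let differentiable_coordB i (c : R) x :
  differentiable (coord i - cst c : 'rV[R]_n -> R) x.
Proof.
by apply: differentiableB; [exact: differentiable_coord|exact: differentiable_cst].
Qed.

Let differentiable_paraboloids x : differentiable paraboloids x.
Proof.
rewrite paraboloidsE; apply: differentiable_sum => i.
by apply: differentiableD; apply: differentiableZ; apply: differentiableX;
  exact: differentiable_coordB.
Qed.

Let is_derive_coordB i (c : R) (x v : 'rV[R]_n) :
  is_derive x v (coord i - cst c) (v 0 i).
Proof.
by have := is_deriveB (is_derive_coord i x v) (is_derive_cst c x v); rewrite subr0.
Qed.

Let partial_paraboloids j : partial j paraboloids = slope j.
Proof.
apply/funext => x; rewrite /partial paraboloidsE.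
have dq i : is_derive x (delta_mx 0 j) (quad i) (slope i x * (i == j)%:R).
  apply: is_derive_eq.
    apply: is_deriveD; apply: is_deriveZ; apply: is_deriveX;
      exact: is_derive_coordB.
  by rewrite /slope !mxE/= !fctE/= !expr1 /GRing.scale/=; ring.
rewrite (@derive_val _ _ _ _ _ _ _ (is_derive_sum dq)).
rewrite (bigD1 j)//= eqxx mulr1 big1 ?addr0// => i /negbTE ->.
by rewrite mulr0.
Qed.

Let partial_slope i j : partial i (slope j) = cst (2 * (a + b) * (i == j)%:R).
Proof.
apply/funext => x; rewrite /partial /slope.
have d : is_derive x (delta_mx 0 i) (slope j) (2 * (a + b) * (i == j)%:R).
  apply: is_derive_eq.
    by apply: is_deriveD; apply: is_deriveZ; exact: is_derive_coordB.
  by rewrite !mxE/= /GRing.scale/= eq_sym; ring.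
exact: (@derive_val _ _ _ _ _ _ _ d).
Qed.

Lemma Ck2_paraboloids A : Ck 2 A paraboloids.
Proof.
split=> [x _|j]; first exact: differentiable_paraboloids.
rewrite partial_paraboloids; split=> [x _|i].
  by apply: differentiableD; apply: differentiableZ; exact: differentiable_coordB.
by rewrite partial_slope => x _; exact: cst_continuous.
Qed.

Lemma grad_paraboloids x :
  grad paraboloids x = (2 * a) *: (x - y) + (2 * b) *: (x - z).
Proof. by apply/rowP => j; rewrite !mxE partial_paraboloids. Qed.

Lemma hess_paraboloids x : hess paraboloids x = (2 * (a + b))%:M.
Proof.
apply/matrixP => i j; rewrite !mxE partial_paraboloids partial_slope/=.
by rewrite mulr_natr.
Qed.

End SumOfTwoParaboloids.

(** * Ellipticity on positive multiples of the identity *)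

Section EllipticScalar.
Variables (R : realType) (n : nat).

Lemma char_poly_scalar (c : R) : char_poly (c%:M : 'M[R]_n) = ('X - c%:P) ^+ n.
Proof.
rewrite char_poly_trig ?scalar_mx_is_trig//.
under eq_bigr do rewrite mxE eqxx mulr1n.
by rewrite prodr_const card_ord.
Qed.

(** The only eigenvalue is [c], with multiplicity [n]; being positive, it leaves the negative sum
    empty. *)
Lemma pucci_max_scalar (lam Lam c : R) : 0 < c ->
  pucci_max lam Lam (c%:M : 'M[R]_n) = Lam * (c *+ n).
Proof.
move=> c0; rewrite /pucci_max /sum_pos_eig /sum_neg_eig char_poly_scalar.
rewrite (fsbigE [:: c])//; last 2 first.
- by move=> e /=; rewrite inE => /eqP ->.
- by move=> e _; rewrite inE mup_XsubCX eq_sym => /negbTE ->; rewrite mulr0n.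
rewrite big_cons big_nil mem_set//= mup_XsubCX eqxx addr0.
rewrite fsbig1 ?mulr0 ?addr0// => e /= e0.
by rewrite mup_XsubCX gt_eqF ?mulr0n// (lt_trans e0).
Qed.

Lemma uniformly_elliptic_scalar (lam Lam : R) (F : 'M[R]_n -> R) (c : R) :
  F 0 = 0 -> uniformly_elliptic lam Lam F -> 0 < c ->
  F c%:M <= Lam * (c *+ n).
Proof.
move=> F0 /(_ c%:M 0); rewrite /Sym/= tr_scalar_mx trmx0 subr0 F0 subr0.
by move=> /(_ erefl erefl)/andP[_] + c0; rewrite pucci_max_scalar.
Qed.

End EllipticScalar.

(** * Growth of subsolutions *)

Section DistanceToFrontier.
Variables (R : realType) (n : nat).
Implicit Types (x y : 'rV[R]_n) (N Omega : set 'rV[R]_n).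

Lemma edist_le x y N : N y -> edist x N <= enorm (y - x).
Proof.
move=> Ny; apply: ge_inf; last by exists y.
by exists 0 => _ [z _ <-]; exact: enorm_ge0.
Qed.

(** The segment from [x] to a point of the ball outside [N] would meet the frontier closer than the
    distance allows. *)
Lemma eball_sub_open N x :
  open N -> N x -> eball x (edist x (frontier N)) `<=` N.
Proof.
move=> oN Nx y; rewrite /eball/= => yr; apply: contrapT => Ny.
have [z fz zy] := segment_meets_frontier oN Nx Ny.
by have := le_lt_trans (le_trans (edist_le x fz) zy) yr; rewrite ltxx.
Qed.

Lemma edist_frontier_gt0 N x : (0 < n)%N -> open N -> bounded_set N -> N x ->
  0 < edist x (frontier N).
Proof.
move=> n0 oN bN Nx.
(* The infimum of an empty set is 0 by default, so the frontier must be shown nonempty; a point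
   outside [N] provides a frontier point. Moving by sup-norm length [2 * M] from [x] leaves the ball
   of radius [M]. *)
have [y Ny] : exists y, ~ N y.
  have [M M0 {}bN] := ex_strict_bound_gt0 bN.
  have NM z : N z -> `|z| < M by exact: bN.
  pose v : 'rV[R]_n := const_mx 1.
  have v0 : 0 < `|v|.
    rewrite normr_gt0; apply/eqP => /rowP/(_ (Ordinal n0)).
    by rewrite !mxE => /eqP; rewrite oner_eq0.
  exists (x + (2 * M / `|v|) *: v) => /NM; rewrite ltNge => /negP; apply.
  have := ler_normB (x + (2 * M / `|v|) *: v) x.
  rewrite addrAC subrr add0r normrZ ger0_norm; last first.
    by rewrite divr_ge0// mulr_ge0// ltW.
  rewrite divfK ?gt_eqF// => h.
  have := NM _ Nx; lra.
have [z fz _] := segment_meets_frontier oN Nx Ny.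
have [d d0 dN] := nbhs_eball (open_nbhs_nbhs (conj oN Nx)).
apply: lt_le_trans d0 _; apply: lb_le_inf; first by exists (enorm (z - x)), z.
move=> _ [w [_ iw] <-]; rewrite leNgt; apply/negP => wd; apply: iw.
by rewrite (proj1 (interior_id _) oN); exact: dN.
Qed.

End DistanceToFrontier.

Section SubsolutionGrowth.
Variables (R : realType) (n : nat) (lam Lam gamma : R) (F : 'M[R]_n -> R).
Hypotheses (Lam_ge0 : 0 <= Lam) (gamma_ge0 : 0 <= gamma).
Hypotheses (F0 : F 0 = 0) (F_elliptic : uniformly_elliptic lam Lam F).

(** At an interior contact point the test function has gradient of norm at most [a * r] and Hessian
    [4 * a] times the identity; the smallness condition on [a] then contradicts the subsolution
    inequality. *)
Lemma subsolution_growth (N : set 'rV[R]_n) (f u : 'rV[R]_n -> R)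
    (x0 : 'rV[R]_n) (r a m : R) :
  visc_subsol F gamma N f u -> eball x0 r `<=` N ->
  (forall x, N x -> m <= f x) -> 0 < r -> 0 < a ->
  (a * r) `^ gamma * (Lam * ((4 * a) *+ n)) < m ->
  exists2 y, enorm (y - x0) = r / 2 & a * (r / 2) ^+ 2 <= u y - u x0.
Proof.
move=> [cu subu] rN mf r0 a0 am.
have r2 : r / 2 < r by lra.
pose w x := u x - a * enorm (x - x0) ^+ 2.
(* Halving the radius keeps the closed ball inside [N], where [u] is continuous, so a maximum
   exists. *)
have cw : {within [set y | enorm (y - x0) <= r / 2], continuous w}.
  apply: continuous_in_subspaceT => y; rewrite inE/= => yr.
  have cy : {for y, continuous u}.
    by apply: cu; apply: rN; exact: le_lt_trans yr r2.
  have ce := @continuous_enormB _ _ x0 y.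
  have ca : {for y, continuous (fun _ : 'rV[R]_n => a)} by exact: cst_continuous.
  exact: continuousB cy (continuousM ca (continuousM ce ce)).
have [|x1 + max1] := EVT_max_rV _ (@compact_closed_eball _ _ x0 (r / 2)) cw.
  by exists x0; rewrite /= subrr enorm0; lra.
rewrite inE/= => x1r.
have ux1 : a * enorm (x1 - x0) ^+ 2 <= u x1 - u x0.
  have := max1 x0; rewrite inE/= subrr enorm0 /w => /(_ ltac:(lra)).
  by rewrite subrr enorm0 expr0n/= mulr0 subr0; lra.
have [x1r2|x1r2] := eqVneq (enorm (x1 - x0)) (r / 2).
  by exists x1; rewrite // -x1r2.
have {}x1r2 : enorm (x1 - x0) < r / 2 by rewrite lt_neqAle x1r2.
have Nx1 : N x1 by apply: rN; exact: lt_trans x1r2 r2.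
(* Adding a |x - x1|^2 makes the contact at x1 strict without changing the
   gradient there. *)
exfalso; have := subu (paraboloids a a x0 x1) x1 (Ck2_paraboloids _ _ _ _ _) Nx1.
have smax : strict_local_max (fun x => u x - paraboloids a a x0 x1 x) x1.
  rewrite /strict_local_max /dnbhs near_withinE; near=> x => xx1.
  have xr : eball x0 (r / 2) x by near: x; exact: eball_nbhs.
  have := max1 x; rewrite inE/= => /(_ (ltW xr)).
  rewrite /w /paraboloids subrr enorm0 expr0n/= mulr0 addr0.
  have : 0 < a * enorm (x - x1) ^+ 2.
    rewrite mulr_gt0// exprn_gt0// lt_def enorm_ge0 andbT.
    by apply: contra_neq xx1 => /enorm_eq0/eqP; rewrite subr_eq0 => /eqP.
  lra.
move=> /(_ smax); apply/negP; rewrite -ltNge; apply: lt_le_trans (mf _ Nx1).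
apply: le_lt_trans am.
rewrite /pde_lhs grad_paraboloids hess_paraboloids subrr scaler0 addr0 enormZ.
have a4 : 2 * (a + a) = 4 * a by lra.
have Fle : F (2 * (a + a))%:M <= Lam * ((4 * a) *+ n).
  by rewrite a4; apply: (uniformly_elliptic_scalar F0 F_elliptic); rewrite mulr_gt0.
apply: le_trans (ler_wpM2l (powR_ge0 _ _) Fle) _.
apply: ler_wpM2r; first by rewrite mulr_ge0// mulrn_wge0// mulr_ge0// ltW.
have a2 : 0 <= 2 * a by lra.
apply: ge0_ler_powR; rewrite ?nnegrE//.
- by rewrite mulr_ge0 ?enorm_ge0.
- by rewrite mulr_ge0// ltW.
- by rewrite ger0_norm//; have := ler_wpM2l a2 (ltW x1r2); lra.
Unshelve. all: by end_near. Qed.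

(** The mean slope from [x0] to the point found above is at least [a * r / 2]. A supremum below
    [a * r / 4] would allow at most half of that growth. *)
Lemma subsolution_gradnorm (N : set 'rV[R]_n) (f u : 'rV[R]_n -> R)
    (x0 : 'rV[R]_n) (r a m : R) :
  visc_subsol F gamma N f u -> eball x0 r `<=` N ->
  (forall x, N x -> m <= f x) -> 0 < r -> 0 < a ->
  (a * r) `^ gamma * (Lam * ((4 * a) *+ n)) < m ->
  ((a * r / 4)%:E <= ereal_sup [set gradnorm u x | x in eball x0 r])%E.
Proof.
move=> subu rN mf r0 a0 am.
have [y yr uy] := subsolution_growth subu rN mf r0 a0 am.
rewrite leNgt; apply/negP => supL.
have ball_t t : 0 <= t <= 1 -> eball x0 r (x0 + t *: (y - x0)).
  move=> /andP[t0 t1]; rewrite /eball/= addrAC subrr add0r enormZ ger0_norm// yr.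
  have := ler_wpM2r (ltW r0) t1; lra.
have ar : 0 < a * r by rewrite mulr_gt0.
have := @gradnorm_mean_value _ _ u x0 (y - x0) (a * r / 4).
rewrite [x0 + _]addrC subrK yr => /(_ ltac:(lra)) mv.
have : u y - u x0 <= a * r / 4 * (r / 2).
  apply: mv => t t01; first by apply: subu.1; apply: rN; exact: ball_t.
  apply: le_lt_trans supL; apply: ereal_sup_ubound.
  by exists (x0 + t *: (y - x0)) => //; exact: ball_t.
have : 0 < a * r * r by rewrite mulr_gt0.
move: uy; nra.
Qed.

End SubsolutionGrowth.

(** * The noncoincidence set and the choice of constants *)

Lemma open_noncoincidence (R : realType) (n : nat) (Omega : set 'rV[R]_n)
    (u phi : 'rV[R]_n -> R) :
  open Omega -> Ck 0 Omega u -> Ck 0 Omega phi ->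
  open (noncoincidence Omega u phi).
Proof.
move=> oO cu cphi; rewrite openE => x [Ox /= ux].
have mid := midf_lt ux.
apply: filterI; first exact: open_nbhs_nbhs.
have lo : \forall y \near x, phi y < (phi x + u x) / 2.
  exact: cphi _ Ox _ (lt_nbhsl mid.1).
have hi : \forall y \near x, (phi x + u x) / 2 < u y.
  exact: cu _ Ox _ (lt_nbhsr mid.2).
by apply: filterS2 lo hi => y; exact: lt_trans.
Qed.

Unset Implicit Arguments.

Theorem corollary1p8 (R : realType) (n : nat) (n_gt0 : (0 < n)%N)
    (Omega : set 'rV[R]_n) (hOmega : smooth_bounded_domain Omega)
    (gamma : R) (gamma_gt0 : 0 < gamma)
    (lam Lam : R) (lam_gt0 : 0 < lam) (lam_le : lam <= Lam)
    (F : 'M[R]_n -> R)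
    (F_convex : @convex_function R 'M[R]_n (@Sym R n) F)
    (F0 : F 0 = 0) (F_elliptic : uniformly_elliptic lam Lam F)
    (beta : R) (beta_gt0 : 0 < beta) (beta_le1 : beta <= 1)
    (phi : 'rV[R]_n -> R) (hphi : C1beta beta Omega phi)
    (g : 'rV[R]_n -> R) (hg : C1beta_boundary beta Omega g)
    (f : 'rV[R]_n -> R) (f_cont : Ck 0 Omega f)
    (f_bounded : [bounded f x | x in Omega])
    (inf_f_gt0 : 0 < inf [set f x | x in Omega])
    (Omega' : set 'rV[R]_n) (hOmega' : compactly_contained Omega' Omega) :
  exists2 c : R, 0 < c &
    forall u : 'rV[R]_n -> R,
      obstacle_solution F gamma Omega phi f g u ->
      [bounded u x | x in Omega] ->
      forall (x0 : 'rV[R]_n) (r : R),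
        (noncoincidence Omega u phi `&` Omega') x0 ->
        r = edist x0 (frontier (noncoincidence Omega u phi)) ->
        ((c * r `^ (1 / (gamma + 1)))%:E
           - (1 / 2)%:E * ereal_sup [set (enorm (grad phi x))%:E | x in eball x0 r]
         <= ereal_sup [set gradnorm u x | x in eball x0 r])%E.
Proof.
set m := inf _ in inf_f_gt0.
have Lam_gt0 : 0 < Lam by apply: lt_le_trans lam_le.
have nR : 0 < n%:R :> R by rewrite ltr0n.
pose K := m / (8 * Lam * n%:R).
have K0 : 0 < K by rewrite divr_gt0// !mulr_gt0.
pose p := 1 / (gamma + 1).
have g1 : 0 < gamma + 1 by lra.
(* This constant involves only [m], [Lam], [n] and [gamma], and is fixed before [u]. *)
exists (K `^ p / 4); first by rewrite divr_gt0// powR_gt0.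
case: hOmega => oO _ _ bO _.
move=> u [_ _ [cu _] [_ subu] _] _ x0 r [Nx0 _] rE.
set N := noncoincidence Omega u phi in rE subu Nx0.
have cphi : Ck 0 Omega phi.
  by move=> x Ox; apply: differentiable_continuous; exact: hphi.1.1.
have oN : open N by exact: open_noncoincidence.
have bN : bounded_set N.
  have [M [Mreal OM]] := bO.
  by exists M; split=> // t Mt x [Ox _]; exact: OM Mt _ Ox.
have r0 : 0 < r by rewrite rE; exact: edist_frontier_gt0.
have rN : eball x0 r `<=` N by rewrite rE; exact: eball_sub_open.
have mf x : N x -> m <= f x.
  move=> [Ox _]; apply: ge_inf; last by exists x.
  have [M M0 bM] := ex_strict_bound_gt0 f_bounded.
  have fM y : Omega y -> `|f y| < M by exact: bM.
  by exists (- M) => _ [y /fM/ltW + <-]; rewrite ler_norml => /andP[].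
pose a := (K * r) `^ p / r.
have Kr : 0 < K * r by rewrite mulr_gt0.
have a0 : 0 < a by rewrite divr_gt0// powR_gt0.
have arE : a * r = (K * r) `^ p by rewrite /a divfK ?gt_eqF.
have aK : (a * r) `^ gamma * a = K.
  apply: (mulIf (lt0r_neq0 r0)); rewrite -mulrA.
  have -> : (a * r) `^ gamma * (a * r) = (a * r) `^ (gamma + 1).
    by rewrite powRD ?(gt_eqF g1)// powRr1// ltW// mulr_gt0.
  by rewrite arE -powRrM /p div1r mulVf ?gt_eqF// powRr1// ltW.
have am : (a * r) `^ gamma * (Lam * ((4 * a) *+ n)) < m.
  have -> : (a * r) `^ gamma * (Lam * ((4 * a) *+ n))
          = (a * r) `^ gamma * a * (4 * Lam * n%:R).
    by rewrite -mulr_natr; ring.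
  have -> : (a * r) `^ gamma * a * (4 * Lam * n%:R) = m / 2.
    by rewrite aK /K; field; rewrite !gt_eqF.
  by rewrite ltr_pdivrMr// mulr_natr mulr2n ltrDr.
apply: le_trans (subsolution_gradnorm (ltW Lam_gt0) (ltW gamma_gt0) F0 F_elliptic
  subu rN mf r0 a0 am).
have -> : K `^ p / 4 * r `^ p = a * r / 4.
  by rewrite arE (powRM _ (ltW K0) (ltW r0)) mulrAC.
(* The supremum of the obstacle gradient may be infinite; only its sign is used, and its value at
   the centre [x0] gives that. *)
rewrite -[leRHS]adde0 leeD2l// oppe_le0 mule_ge0 ?lee_fin//.
apply: (@le_trans _ _ (enorm (grad phi x0))%:E).
  by rewrite lee_fin enorm_ge0.
by apply: ereal_sup_ubound; exists x0; rewrite // /eball/= subrr enorm0.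
Qed.
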